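(* Consider the Bayesian model with exponential prior on the error variance described in the context, with $L$ nondecreasing and $0<L(u)\le M<\infty$. For any $0<u<1$ and $0<\delta<1$ there is a constant $C>0$, not depending on $\tau$ or $X_i$, such that for all $0<\tau<1$ and every value of $X_i\in\mathbb{R}$, $$\mathbb{E}\big(\kappa_i I_{[\kappa_i>u]}\mid X_i\big)\le C\,\tau^{-2a}\exp\big[-u^{1/2}(1-\delta^{1/2})|X_i|\big].$$
   Context: Model (for given $\tau>0$): (i) $X_i\mid\theta_i,\sigma_i^2\sim N(\theta_i,\sigma_i^2)$ independently, $i=1,\dots,n$; (ii) $\theta_i\mid\sigma_i^2,\lambda_i^2,\tau^2\sim N(0,\sigma_i^2\lambda_i^2\tau^2)$ independently; (iii) $\lambda_1^2,\dots,\lambda_n^2,\sigma_1^2,\dots,\sigma_n^2$ are mutually independent, each $\lambda_i^2$ having the proper prior density $\Pi(\lambda_i^2)=K(\lambda_i^2)^{-a-1}L(\lambda_i^2)$ on $(0,\infty)$, with $a>0$, $K>0$ the normalizing constant, and $L$ a slowly varying function (at infinity); (iv) each $\sigma_i^2$ has prior density $\Pi(\sigma_i^2)=\tfrac12\exp(-\sigma_i^2/2)$ on $(0,\infty)$. Standing assumption on $L$: it is nondecreasing and $0<L(u)\le M<\infty$ for all $u>0$. The shrinkage factor is $\kappa_i=(1+\lambda_i^2\tau^2)^{-1}$, and $\mathbb{E}(\cdot\mid X_i)$ denotes posterior expectation given $X_i$ under this model. *)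

(* Defs.v *)
From mathcomp Require Export all_boot all_order all_algebra.
From mathcomp Require Export all_classical all_reals all_analysis.
Export Order.TTheory GRing.Theory Num.Theory.
Export numFieldNormedType.Exports.

Set Implicit Arguments.
Unset Strict Implicit.
Unset Printing Implicit Defensive.

Local Open Scope classical_set_scope.
Local Open Scope ring_scope.

Definition slowly_varying (R : realType) (L : R -> R) : Prop :=
  forall t : R, 0 < t -> L (t * x) / L x @[x --> +oo] --> (1 : R).

Definition local_prior_density (R : realType) (K a : R) (L : R -> R) (l : R) : R :=
  K * l `^ (- a - 1) * L l.

(* [sigma2] and [lambda2] are the squared quantities sigma_j^2, lambda_j^2.
   The library's [normal_prob m s] and [normal_pdf m s] take the standard
   deviation [s], hence the square roots.
   A conditional law "Y_j | V independently ~ Q_j(V)" is expressed by its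
   defining property: P (Y_j \in A_j for all j, V \in G) is the integral over
   the event V \in G of the product of the Q_j(V)(A_j), where G ranges over the
   measurable rectangles, which generate the sigma-algebra of V. *)
Record hierarchical_model (R : realType) (K a : R) (L : R -> R) (tau : R)
    (n : nat) (d : measure_display) (T : measurableType d) (P : probability T R)
    (X theta lambda2 sigma2 : 'I_n -> {RV P >-> R}) : Prop := {
  X_law : forall A B C D : 'I_n -> set R,
    (forall j, measurable (A j)) -> (forall j, measurable (B j)) ->
    (forall j, measurable (C j)) -> (forall j, measurable (D j)) ->
    P [set w | forall j, [/\ A j (X j w), B j (theta j w),
                             C j (lambda2 j w) & D j (sigma2 j w)]] =
    (\int[P]_(w in [set w | forall j, [/\ B j (theta j w),
                             C j (lambda2 j w) & D j (sigma2 j w)]])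
       \big[*%E/1%E]_(j < n)
          normal_prob (theta j w) (Num.sqrt (sigma2 j w)) (A j))%E ;
  theta_law : forall B C D : 'I_n -> set R,
    (forall j, measurable (B j)) ->
    (forall j, measurable (C j)) -> (forall j, measurable (D j)) ->
    P [set w | forall j, [/\ B j (theta j w),
                             C j (lambda2 j w) & D j (sigma2 j w)]] =
    (\int[P]_(w in [set w | forall j, C j (lambda2 j w) /\ D j (sigma2 j w)])
       \big[*%E/1%E]_(j < n)
          normal_prob 0%R
            (Num.sqrt (sigma2 j w * lambda2 j w * tau ^+ 2)) (B j))%E ;
  scales_independent : forall C D : 'I_n -> set R,
    (forall j, measurable (C j)) -> (forall j, measurable (D j)) ->
    P [set w | forall j, C j (lambda2 j w) /\ D j (sigma2 j w)] =
    (\big[*%E/1%E]_(j < n) P (lambda2 j @^-1` C j) *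
     \big[*%E/1%E]_(j < n) P (sigma2 j @^-1` D j))%E ;
  lambda2_law : forall (j : 'I_n) (C : set R), measurable C ->
    distribution P (lambda2 j) C =
    (\int[lebesgue_measure]_(l in C `&` `]0%R, +oo[)
       (local_prior_density K a L l)%:E)%E ;
  sigma2_law : forall (j : 'I_n) (D : set R), measurable D ->
    distribution P (sigma2 j) D = exponential_prob (2^-1 : R) D
}.

Definition shrinkage (R : realType) (tau l : R) : R := (1 + l * tau ^+ 2)^-1.

(* E(Y | X_i = x) by Bayes' formula, i being the index of [theta] and [sigma2]:
   the conditional density of X_i at x given all the parameters is that of
   N(theta_i, sigma_i^2). This version of the conditional expectation is
   defined at every x, and Y should be a function of the parameters only. *)
Definition posterior_expectation (R : realType) (d : measure_display)
    (T : measurableType d) (P : probability T R)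
    (theta sigma2 : {RV P >-> R}) (x : R) (Y : T -> R) : R :=
  let lik w := normal_pdf (theta w) (Num.sqrt (sigma2 w)) x in
  fine 'E_P[fun w => Y w * lik w] / fine 'E_P[lik].

(* Main.v *)
From HB Require Import structures.
Require Import Defs.
From mathcomp Require Import ring lra measurable_realfun.

(* Integrating theta and then sigma^2 out of the joint law shows that
   E(f(lambda^2); X = x) is the prior mean of f(lambda^2) D(kappa), where D(k)
   is the density at x of a centred Gaussian of variance s / k mixed over
   s ~ Exp(1/2). This density is (sqrt k / 2) exp(- sqrt k |x|), but two-sided
   bounds suffice, because the exponents at hand leave some room.
   - Numerator: on kappa > u, the inequality s / 2 + u x^2 / (2 s) >= sqrt u |x|
     gives D(kappa) <= const * exp(- (1 - eta) sqrt u |x|); the fraction eta of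
     the exponent keeps the integral over s finite.
   - Denominator: lambda^2 in [A / tau^2, 2 A / tau^2] forces
     sqrt kappa <= eta sqrt u, and the prior mass of this interval is at least
     const * tau^(2a) since L is nondecreasing.
   With eta = sqrt delta / 2 the quotient of the exponentials is the one
   claimed. *)

Set Implicit Arguments.
Unset Strict Implicit.
Unset Printing Implicit Defensive.

Local Open Scope classical_set_scope.
Local Open Scope ring_scope.

(** * Densities, product measures and measurability *)

Import HBNNSimple.

Section density.
Local Open Scope ereal_scope.
Context d (T : measurableType d) (R : realType).
Implicit Types mu nu : {measure set T -> \bar R}.

(** Both sides are limits along the simple approximations [h n] of [f], by monotone convergence. For
    a simple function the identity follows by linearity from [nuE] on its level sets. *)
Lemma ge0_integral_density mu nu (p : T -> R) :
  measurable_fun setT p -> (forall x, 0 <= p x)%R ->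
  (forall A, measurable A -> nu A = \int[mu]_(x in A) (p x)%:E) ->
  forall f : T -> \bar R, measurable_fun setT f -> (forall x, 0 <= f x) ->
  \int[nu]_x f x = \int[mu]_x (f x * (p x)%:E).
Proof.
move=> mp p0 nuE f mf f0.
have mEp : measurable_fun setT (EFin \o p) by exact/measurable_EFinP.
pose h := nnsfun_approx measurableT mf.
have fh x : f x = limn (EFin \o h ^~ x).
  by apply/esym/cvg_lim => //; exact: cvg_nnsfun_approx.
have -> : \int[nu]_x f x = limn (fun n => \int[nu]_x (h n x)%:E).
  under eq_integral do rewrite fh.
  apply: monotone_convergence => //.
  - by move=> n; exact/measurable_EFinP.
  - by move=> n x _; rewrite lee_fin.
  - by move=> x _ a b ab; rewrite lee_fin; exact/lefP/nd_nnsfun_approx.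
have -> : \int[mu]_x (f x * (p x)%:E) =
    limn (fun n => \int[mu]_x ((h n x)%:E * (p x)%:E)).
  have fp x : f x * (p x)%:E = limn (fun n => (h n x)%:E * (p x)%:E).
    apply/esym/cvg_lim => //; apply: cvgeZr => //.
    exact: cvg_nnsfun_approx.
  under eq_integral do rewrite fp.
  apply: monotone_convergence => //.
  - by move=> n; apply: emeasurable_funM => //; exact/measurable_EFinP.
  - by move=> n x _; rewrite mule_ge0 ?lee_fin.
  - move=> x _ a b ab; rewrite lee_wpmul2r ?lee_fin//.
    exact/lefP/nd_nnsfun_approx.
congr (limn _); apply/funext => n.
have hE x : (h n x)%:E =
    \sum_(y \in range (h n)) (y * \1_(h n @^-1` [set y]) x)%:E.
  by rewrite fsumEFin// -fimfunE.
have mh y : measurable_fun setT (fun x => (y * \1_(h n @^-1` [set y]) x)%:E).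
  by apply/measurable_EFinP; exact: measurable_funM.
under eq_integral do rewrite hE.
rewrite ge0_integral_fsum//; last by move=> y x _; exact: nnfun_muleindic_ge0.
under [RHS]eq_integral => x _.
  rewrite hE ge0_mule_fsuml; last by move=> y; exact: nnfun_muleindic_ge0.
  over.
rewrite ge0_integral_fsum//; last 2 first.
- by move=> y; exact: emeasurable_funM.
- by move=> y x _; rewrite mule_ge0 ?lee_fin//; exact: nnfun_muleindic_ge0.
apply: eq_fsbigr => y yh.
rewrite integralZl_indic_nnsfun// integral_indic// setIT nuE//.
have y0 : (0 <= y)%R by move: yh; rewrite inE => -[x _ <-].
under [RHS]eq_integral do rewrite EFinM -muleA.
rewrite ge0_integralZl//; last 2 first.
- by apply: emeasurable_funM => //; apply/measurable_EFinP.
- by move=> x _; rewrite mule_ge0 ?lee_fin.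
congr (_ * _).
rewrite integral_mkcond/=; apply: eq_integral => x _.
by rewrite muleC epatch_indic.
Qed.

End density.

Section rectangles.
Context d1 d2 (T1 : measurableType d1) (T2 : measurableType d2) (R : realType).

(** Rectangles form a generating pi-system containing the whole space, so finite total mass is
    enough for uniqueness, with a constant exhausting sequence. *)
Lemma measure_eq_rectangles (m1 m2 : {measure set (T1 * T2) -> \bar R}) :
  (m1 setT < +oo)%E ->
  (forall A B, measurable A -> measurable B -> m1 (A `*` B) = m2 (A `*` B)) ->
  forall E, measurable E -> m1 E = m2 E.
Proof.
move=> m1oo m12 E mE.
pose G : set (set (T1 * T2)) :=
  [set A `*` B | A in measurable & B in measurable].
apply: (measure_unique G (fun=> setT)) => //.
- by rewrite measurable_prod_measurableType.
- move=> _ _ [A1 mA1 [B1 mB1 <-]] [A2 mA2 [B2 mB2 <-]].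
  rewrite -setXI; exists (A1 `&` A2); first exact: measurableI.
  by exists (B1 `&` B2) => //; exact: measurableI.
- by move=> _; exists setT => //; exists setT => //; rewrite setXTT.
- by rewrite bigcup_const.
- by move=> _ [A mA [B mB <-]]; exact: m12.
Qed.

End rectangles.

(** The rectangle case is used twice. For a fixed [C], the map sending [H] to the mass of [H x C] is
    a measure on [T1 * T2], namely the pushforward by the first projection of a restricted measure,
    and its values on rectangles are values on boxes. *)
Lemma measure_eq_boxes d1 d2 d3 (T1 : measurableType d1)
    (T2 : measurableType d2) (T3 : measurableType d3) (R : realType)
    (m1 m2 : {measure set (T1 * T2 * T3) -> \bar R}) :
  (m1 setT < +oo)%E ->
  (forall A B C, measurable A -> measurable B -> measurable C ->
    m1 (A `*` B `*` C) = m2 (A `*` B `*` C)) ->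
  forall E, measurable E -> m1 E = m2 E.
Proof.
move=> m1oo m12; apply: measure_eq_rectangles => // G C mG mC.
have mTC : measurable ([set: T1 * T2] `*` C) by exact: measurableX.
pose n1 : {measure set (T1 * T2) -> \bar R} :=
  pushforward (mrestr m1 mTC) (@fst (T1 * T2)%type T3).
pose n2 : {measure set (T1 * T2) -> \bar R} :=
  pushforward (mrestr m2 mTC) (@fst (T1 * T2)%type T3).
have nE (m : {measure set (T1 * T2 * T3) -> \bar R}) H :
    pushforward (mrestr m mTC) (@fst (T1 * T2)%type T3) H = m (H `*` C).
  rewrite /pushforward /mrestr; congr (m _).
  by apply/seteqP; split => [[x y]|[x y]] /=; tauto.
rewrite -!nE; suff: n1 measurable_fst G = n2 measurable_fst G by [].
apply: measure_eq_rectangles => //.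
- rewrite [X in (X < _)%E](nE m1); apply: le_lt_trans m1oo.
  apply: le_measure; rewrite ?inE//.
- move=> A B mA mB; rewrite [LHS](nE m1) [RHS](nE m2); exact: m12.
Qed.

Section measurability.
Context d (T : measurableType d) (R : realType).

Lemma measurable_fun_expR (f : T -> R) :
  measurable_fun setT f -> measurable_fun setT (fun w => expR (f w)).
Proof. by move=> mf; exact: measurableT_comp. Qed.

Lemma measurable_fun_inv (f : T -> R) :
  measurable_fun setT f -> measurable_fun setT (fun w => (f w)^-1).
Proof.
(* Squaring makes the base of the power nonnegative, so that the power -1 is an inverse there. At a
   zero of [f] both sides vanish, since the inverse of 0 is 0. *)
move=> mf; rewrite (_ : (fun w => _) = (fun w => f w * (f w ^+ 2) `^ (- 1))).
  apply: measurable_funM => //.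
  apply: (@measurableT_comp _ _ _ _ _ _ (@powR R ^~ (- 1))).
    exact: measurable_powR.
  exact: measurable_funX.
apply/funext => w; rewrite powRN powRr1 ?sqr_ge0//.
have [->|f0] := eqVneq (f w) 0; first by rewrite invr0 mul0r.
by rewrite expr2 invfM mulrA divff// mul1r.
Qed.

Lemma measurable_fun_sqrt (f : T -> R) :
  measurable_fun setT f -> measurable_fun setT (fun w => Num.sqrt (f w)).
Proof.
move=> mf; apply: (measurableT_comp _ mf).
by apply: continuous_measurable_fun; exact: sqrt_continuous.
Qed.

Lemma measurable_normal_pdf_comp (m s x : T -> R) :
  measurable_fun setT m -> measurable_fun setT s -> measurable_fun setT x ->
  measurable_fun setT (fun w => normal_pdf (m w) (s w) (x w)).
Proof.
(* [normal_pdf] has a separate branch, an indicator function, for a zero standard deviation. *)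
move=> mm ms mx; apply: measurable_fun_ifT.
- exact: measurable_fun_eqr.
- by apply: measurableT_comp => //; exact: measurable_indic.
- have ms2 := measurable_funX 2 ms; apply: measurable_funM.
    apply/measurable_fun_inv/measurable_fun_sqrt.
    by apply: measurable_funD; exact: measurable_funM.
  apply/measurable_fun_expR/measurable_funM.
    apply: measurableT_comp => //; apply: measurable_funX.
    exact: measurable_funB.
  by apply: measurable_fun_inv; exact: measurable_funD.
Qed.

End measurability.

Section density_measure.
Local Open Scope ereal_scope.
Context d (T : measurableType d) (R : realType).
Variables (mu : {measure set T -> \bar R}) (p : T -> R).
Hypotheses (mp : measurable_fun setT p) (p0 : forall x, (0 <= p x)%R).

(** The conditions on [p] are arguments, so that the term itself carries what the measure instance
    below requires. *)
Definition density_measure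
    of measurable_fun setT p & (forall x, (0 <= p x)%R) :=
  fun A : set T => \int[mu]_(x in A) (p x)%:E.

Local Notation nu := (density_measure mp p0).

Let nu0 : nu set0 = 0.
Proof. exact: integral_set0. Qed.

Let nu_ge0 A : 0 <= nu A.
Proof. by apply: integral_ge0 => x _; rewrite lee_fin. Qed.

Let nu_sigma_additive : semi_sigma_additive nu.
Proof.
move=> F mF tF mUF; rewrite /nu; apply: cvg_toP.
  apply: ereal_nondecreasing_is_cvgn => m n mn.
  by apply: lee_sum_nneg_natr => // k _ _; exact: nu_ge0.
rewrite [RHS]ge0_integral_bigcup//=.
- exact/measurable_funTS/measurable_EFinP.
- by move=> x _; rewrite lee_fin.
Qed.

HB.instance Definition _ := isMeasure.Build _ _ _
  nu nu0 nu_ge0 nu_sigma_additive.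

End density_measure.

Lemma ge0_integral_product3 d1 d2 d3 (T1 : measurableType d1)
    (T2 : measurableType d2) (T3 : measurableType d3) (R : realType)
    (m1 : subprobability T1 R) (m2 : subprobability T2 R)
    (m3 : {sigma_finite_measure set T3 -> \bar R})
    (f : T1 * T2 * T3 -> \bar R) :
  measurable_fun setT f -> (forall z, 0 <= f z)%E ->
  (\int[product_subprobability (m1, m2) \x m3]_z f z =
   \int[m1]_x \int[m2]_y \int[m3]_t f (x, y, t))%E.
Proof.
move=> mf f0.
rewrite (fubini_tonelli1 f mf f0).
apply: (@fubini_tonelli1 _ _ _ _ _ m1 m2 (fubini_F m3 f)).
- exact: measurable_fun_fubini_tonelli_F.
- by move=> z; apply: integral_ge0.
Qed.

(** * Integration against a joint density built from a conditional one *)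

Section joint_density.
Context d d1 d2 d3 (T : measurableType d) (T1 : measurableType d1)
  (T2 : measurableType d2) (T3 : measurableType d3) (R : realType).
Variables (P : probability T R) (U : T -> T1) (V : T -> T2) (Y : T -> T3).
Variables (m1 : probability T1 R) (m2 : probability T2 R).
Variables (mu : {sigma_finite_measure set T3 -> \bar R})
  (p : T1 * T2 -> T3 -> R).
Hypotheses (mU : measurable_fun setT U) (mV : measurable_fun setT V)
  (mY : measurable_fun setT Y).
Hypotheses (mp : measurable_fun setT (fun z : T1 * T2 * T3 => p z.1 z.2))
  (p0 : forall v t, 0 <= p v t).

(** The law of [(U, V, Y)] has density [p] with respect to the product of [m1], [m2] and [mu]: the
    two measures agree on boxes by independence and the conditional law, hence everywhere. Tonelli
    then gives the iterated integral. *)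
Lemma ge0_integral_joint_density :
  (forall C D, measurable C -> measurable D ->
    P (U @^-1` C `&` V @^-1` D) = m1 C * m2 D)%E ->
  (forall C D B, measurable C -> measurable D -> measurable B ->
    P (U @^-1` C `&` V @^-1` D `&` Y @^-1` B) =
    \int[P]_(w in U @^-1` C `&` V @^-1` D)
      \int[mu]_(t in B) (p (U w, V w) t)%:E)%E ->
  forall g : T1 * T2 * T3 -> \bar R,
  measurable_fun setT g -> (forall z, 0 <= g z)%E ->
  (\int[P]_w g (U w, V w, Y w) =
   \int[m1]_l \int[m2]_s
      \int[mu]_t (g (l, s, t) * (p (l, s) t)%:E))%E.
Proof.
move=> indUV condY g mg g0.
pose Q := product_subprobability
  (m1 : subprobability _ _, m2 : subprobability _ _).
have mUV : measurable_fun setT (fun w => (U w, V w)).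
  exact: measurable_fun_pair.
have mUVY : measurable_fun setT (fun w => (U w, V w, Y w)).
  exact: measurable_fun_pair.
pose lawUV : {measure set (T1 * T2) -> \bar R} :=
  pushforward P (fun w => (U w, V w)).
have QE E : measurable E -> Q E = lawUV mUV E.
  by move: E; apply: product_measure_unique => C D mC mD; exact: indUV.
have p0' (z : T1 * T2 * T3) : 0 <= p z.1 z.2 by [].
have mEp : measurable_fun setT (fun z : T1 * T2 * T3 => (p z.1 z.2)%:E).
  exact/measurable_EFinP.
rewrite -(@ge0_integral_product3 _ _ _ _ _ _ _ m1
    m2 mu (fun z => g z * (p z.1 z.2)%:E)%E);
  last 2 first.
- exact: emeasurable_funM.
- by move=> z; rewrite mule_ge0 ?lee_fin.
transitivity (\int[pushforward P (fun w => (U w, V w, Y w))]_z g z)%E.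
  by rewrite ge0_integral_pushforward.
pose law : {measure set (T1 * T2 * T3) -> \bar R} :=
  pushforward P (fun w => (U w, V w, Y w)).
apply: (@ge0_integral_density _ _ _ _ (law mUVY) (fun z => p z.1 z.2)) => //.
pose nu := density_measure (Q \x mu)%E mp p0'.
suff: forall A, measurable A -> law mUVY A = nu A by [].
apply: measure_eq_boxes.
  by rewrite /= /pushforward preimage_setT probability_setT ltry.
move=> C D B mC mD mB.
transitivity (P (U @^-1` C `&` V @^-1` D `&` Y @^-1` B)) => //.
rewrite condY//.
(* Moving the restriction to [B] into the integrand makes [h] a partial integral over the whole
   space, whose measurability is part of Tonelli's theorem. *)
pose k (z : T1 * T2 * T3) := ((p z.1 z.2)%:E * (\1_B z.2)%:E)%E.
have k0 z : (0 <= k z)%E by rewrite mule_ge0 ?lee_fin.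
have mk : measurable_fun setT k.
  apply: emeasurable_funM => //; apply/measurable_EFinP.
  by apply: measurableT_comp => //; exact: measurable_indic.
pose h v := (\int[mu]_(t in B) (p v t)%:E)%E.
have hE : fubini_F mu k = h.
  apply/funext => v; rewrite /fubini_F /h [RHS]integral_mkcond/=.
  by apply: eq_integral => t _; rewrite epatch_indic.
have h0 v : (0 <= h v)%E by apply: integral_ge0 => t _; rewrite lee_fin.
have mh : measurable_fun setT h.
  by rewrite -hE; exact: measurable_fun_fubini_tonelli_F.
have mCD : measurable (C `*` D) by exact: measurableX.
transitivity (\int[Q]_(v in C `*` D) h v)%E.
  rewrite (eq_measure_integral (lawUV mUV)).
    rewrite ge0_integral_pushforward//.
    exact: measurable_funTS.
  by move=> E mE _; exact: QE.
pose k' (z : T1 * T2 * T3) := (k z * (\1_(C `*` D) z.1)%:E)%E.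
transitivity (\int[Q \x mu]_z k' z)%E; last first.
  rewrite [RHS]integral_mkcond; apply: eq_integral => z _.
  rewrite epatch_indic /k' /k -muleA; congr (_ * _)%E.
  rewrite -EFinM; congr (_%:E).
  by rewrite !indicE !in_setX -natrM mulnb andbC.
have mk' : measurable_fun setT k'.
  apply: emeasurable_funM => //; apply/measurable_EFinP.
  by apply: measurableT_comp => //; exact: measurable_indic.
have k'0 z : (0 <= k' z)%E by rewrite mule_ge0 ?k0 ?lee_fin.
rewrite (fubini_tonelli1 k' mk' k'0).
rewrite [LHS]integral_mkcond; apply: eq_integral => v _.
rewrite epatch_indic /fubini_F /k'/=.
rewrite ge0_integralZr//.
- by rewrite -hE.
- exact: measurableT_comp.
Qed.

End joint_density.

(** * Gaussian and exponential integrals *)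

Section gaussian_convolution.
Variable R : realType.
Implicit Types m s r x t : R.

(** Completing the square in [t]: likelihood times prior equals the marginal density of [x] times
    the posterior density of [t]. *)
Lemma normal_pdfM s r x t : 0 < s -> 0 < r ->
  normal_pdf t s x * normal_pdf 0 r t =
  normal_pdf 0 (Num.sqrt (s ^+ 2 + r ^+ 2)) x *
  normal_pdf (r ^+ 2 * x / (s ^+ 2 + r ^+ 2))
    (s * r / Num.sqrt (s ^+ 2 + r ^+ 2)) t.
Proof.
move=> s0 r0; set S := Num.sqrt _.
have S2 : S ^+ 2 = s ^+ 2 + r ^+ 2 by rewrite sqr_sqrtr// addr_ge0 ?sqr_ge0.
have S0 : 0 < S by rewrite sqrtr_gt0 addr_gt0 ?exprn_gt0.
have d0 : 0 < s * r / S by rewrite divr_gt0 ?mulr_gt0.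
rewrite !normal_pdfE ?gt_eqF// mulrACA [RHS]mulrACA; congr (_ * _).
  rewrite /normal_peak -!invfM -!sqrtrM ?pmulrn_lge0 ?mulr_ge0 ?sqr_ge0
    ?pi_ge0 ?ltW//.
  congr (Num.sqrt _)^-1.
  rewrite !exprMn exprVn.
  by field; rewrite gt_eqF.
rewrite /normal_fun -!expRD; congr expR.
rewrite !exprMn exprVn -S2.
(* Eliminating [r] leaves a rational identity in [S] and [s]; its denominator [S ^+ 2 - s ^+ 2] is
   nonzero because it equals [r ^+ 2]. *)
have -> : r ^+ 2 = S ^+ 2 - s ^+ 2 by rewrite S2; ring.
field.
rewrite !gt_eqF//=.
by rewrite S2 addrC addKr exprn_gt0.
Qed.

Lemma normal_pdf_convolution s r x : 0 < s -> 0 < r ->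
  (\int[lebesgue_measure]_t (normal_pdf t s x * normal_pdf 0 r t)%:E =
   (normal_pdf 0 (Num.sqrt (s ^+ 2 + r ^+ 2)) x)%:E)%E.
Proof.
move=> s0 r0; under eq_integral do rewrite normal_pdfM// EFinM.
rewrite ge0_integralZl_EFin ?normal_pdf_ge0//.
- by rewrite integral_normal_pdf mule1.
- by move=> t _; rewrite lee_fin normal_pdf_ge0.
- by apply/measurable_EFinP; exact: measurable_normal_pdf.
Qed.

End gaussian_convolution.

(** * Integrals with an exponential weight *)

Section exponential.
Variable R : realType.
Local Notation leb := (@lebesgue_measure R).

Lemma ge0_integral_exponential
    (nu : {measure set (measurableTypeR R) -> \bar R}) (b : R)
    (f : R -> \bar R) : 0 < b ->
  (forall D, measurable D -> nu D = exponential_prob b D) ->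
  measurable_fun setT f -> (forall s, 0 <= f s)%E ->
  (\int[nu]_s f s =
   \int[leb]_(s in `]0%R, +oo[) (f s * (b * expR (- b * s))%:E))%E.
Proof.
move=> b0 nuE mf f0.
have mp := @measurable_exponential_pdf R b.
rewrite (@ge0_integral_density _ _ _ leb nu (exponential_pdf b))//; last first.
  by move=> s; rewrite exponential_pdf_ge0// ltW.
(* [exponential_pdf] lives on the closed half-line. Its endpoint is Lebesgue-null and is dropped, so
   that later estimates may assume [0 < s]. *)
transitivity (\int[leb]_(s in `[0%R, +oo[) (f s * (b * expR (- b * s))%:E))%E.
  rewrite [RHS]integral_mkcond; apply: eq_integral => s _.
  rewrite /exponential_pdf !patchE; case: ifPn => //.
  by rewrite mule0.
rewrite integral_itv_obnd_cbnd//.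
apply: measurable_funTS; apply: emeasurable_funM => //.
apply/measurable_EFinP; apply: measurable_funM => //.
by apply: measurable_fun_expR; exact: measurable_funM.
Qed.

(** The primitive [2 * Num.sqrt s] is not differentiable at 0. The fundamental theorem is therefore
    applied on the intervals [F n], which increase to the half-open interval; [n.+2] keeps their
    left endpoint strictly below 1. *)
Lemma integral_invsqrt_le2 :
  (\int[leb]_(s in `]0%R, 1%R]) ((Num.sqrt s)^-1)%:E <= 2%:E)%E.
Proof.
pose F (n : nat) : set R := `[n.+2%:R^-1, 1]%classic.
have FE : `]0%R, 1%R]%classic = \bigcup_n F n.
  apply/seteqP; split => [s|s [n _]]; rewrite /F/= !in_itv/=.
    move=> /andP[s0 s1]; exists (Num.truncn s^-1) => //=.
    rewrite in_itv/= s1 andbT invf_ple ?posrE// ltW//.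
    apply: (lt_trans (truncnS_gt _)).
    by rewrite ltr_nat.
  by move=> /andP[ns ->]; rewrite andbT (lt_le_trans _ ns).
have mG : measurable_fun [set: R] (fun s : R => ((Num.sqrt s)^-1)%:E).
  by apply/measurable_EFinP/measurable_fun_inv/measurable_fun_sqrt.
have cvgF : (\int[leb]_(s in F n) ((Num.sqrt s)^-1)%:E @[n --> \oo] -->
    \int[leb]_(s in \bigcup_n F n) ((Num.sqrt s)^-1)%:E)%E.
  apply: (@ge0_nondecreasing_set_cvg_integral _ (measurableTypeR R)).
  - move=> m n mn; rewrite subsetEset; apply: subset_itvr.
    by rewrite bnd_simp lef_pV2 ?posrE ?ler_nat.
  - by move=> n; exact: measurable_itv.
  - by move=> n; exact: measurable_funTS.
  - by move=> n s _; rewrite lee_fin invr_ge0 sqrtr_ge0.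
rewrite FE -(cvg_lim _ cvgF)//.
apply: lime_le.
  apply: ereal_nondecreasing_is_cvgn => m n mn.
  apply: ge0_subset_integral.
  - exact: measurable_itv.
  - exact: measurable_itv.
  - exact: measurable_funTS.
  - by move=> s _; rewrite lee_fin invr_ge0 sqrtr_ge0.
  - apply: subset_itvr.
    by rewrite bnd_simp lef_pV2 ?posrE ?ler_nat.
apply: nearW => n; rewrite /F.
have n0 : 0 < n.+2%:R^-1 :> R by rewrite invr_gt0.
rewrite (@continuous_FTC2 R _ (fun s => 2 * Num.sqrt s)).
- rewrite sqrtr1 mulr1 -EFinB lee_fin lerBlDr lerDl.
  by rewrite mulr_ge0 ?sqrtr_ge0.
- by rewrite invf_lt1// ltr1n.
- apply: continuous_in_subspaceT => s; rewrite inE/= in_itv/= => /andP[ns _].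
  apply: continuousV; last exact: sqrt_continuous.
  by rewrite gt_eqF// sqrtr_gt0 (lt_le_trans _ ns).
- split.
  + move=> s; rewrite in_itv/= => /andP[ns _].
    have s0 : 0 < s by exact: lt_trans ns.
    have [] := is_derive1_sqrt s0 => ds _.
    exact: (derivableM (derivable_cst _ _ _) ds).
  + apply: cvg_at_right_filter; apply: cvgM; first exact: cvg_cst.
    exact: sqrt_continuous.
  + apply: cvg_at_left_filter; apply: cvgM; first exact: cvg_cst.
    exact: sqrt_continuous.
- move=> s; rewrite in_itv/= => /andP[ns _].
  have s0 : 0 < s by exact: lt_trans ns.
  have [ds dE] := is_derive1_sqrt s0.
  rewrite derive1Ml// derive1E dE invfM mulrA divff ?mul1r//.
Qed.

(** The integrand is dominated by [f + g]: on []0, 1]] the exponential is at most 1, and beyond 1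
    the inverse square root is. *)
Lemma integral_invsqrt_exp_lty (b : R) : 0 < b ->
  (\int[leb]_(s in `]0%R, +oo[) ((Num.sqrt s)^-1 * expR (- b * s))%:E < +oo)%E.
Proof.
move=> b0.
pose f (s : R) := (((fun s : R => ((Num.sqrt s)^-1)%:E) \_ `]0%R, 1%R]) s)%E.
pose g (s : R) := (b^-1%:E * (exponential_pdf b s)%:E)%E.
have mf : measurable_fun setT f.
  apply/measurable_restrict => //; apply: measurable_funTS.
  by apply/measurable_EFinP/measurable_fun_inv/measurable_fun_sqrt.
have mg : measurable_fun setT g.
  apply: emeasurable_funM => //; apply/measurable_EFinP.
  exact: measurable_exponential_pdf.
have f0 s : (0 <= f s)%E.
  by rewrite /f patchE; case: ifPn => // _; rewrite lee_fin invr_ge0 sqrtr_ge0.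
have g0 s : (0 <= g s)%E.
  by rewrite mule_ge0 ?lee_fin ?invr_ge0 ?exponential_pdf_ge0// ltW.
apply: (@le_lt_trans _ _ (\int[leb]_s (f s + g s))%E); last first.
  rewrite ge0_integralD//; apply: (@le_lt_trans _ _ (2%:E + b^-1%:E)%E).
    rewrite leeD//; first by rewrite /f -integral_mkcond integral_invsqrt_le2.
    rewrite ge0_integralZl_EFin ?invr_ge0 ?(ltW b0)//.
    + by rewrite integral_exponential_pdf// mule1.
    + by move=> s _; rewrite lee_fin exponential_pdf_ge0// ltW.
    + by apply/measurable_EFinP; exact: measurable_exponential_pdf.
  by rewrite -EFinD ltry.
apply: (@le_trans _ _ (\int[leb]_(s in `]0%R, +oo[) (f s + g s))%E); last first.
  apply: ge0_subset_integral => //.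
  - exact: emeasurable_funD.
  - by move=> s _; rewrite adde_ge0.
apply: ge0_le_integral => //.
- apply: measurable_funTS; apply/measurable_EFinP; apply: measurable_funM.
    by apply/measurable_fun_inv/measurable_fun_sqrt.
  by apply: measurable_fun_expR; exact: measurable_funM.
- by apply: measurable_funTS; exact: emeasurable_funD.
move=> s; rewrite /= in_itv/= andbT => s0.
rewrite /g exponential_pdfE ?(ltW s0)// -EFinM mulrA mulVf ?gt_eqF// mul1r.
rewrite /f patchE mem_setE/= in_itv/= s0/=.
have [s1|s1] := leP s 1.
  rewrite -EFinD lee_fin (@le_trans _ _ (Num.sqrt s)^-1) ?lerDl ?expR_ge0//.
  rewrite ler_piMr ?invr_ge0 ?sqrtr_ge0// -expR0 ler_expR.
  by rewrite mulNr oppr_le0 mulr_ge0 ?ltW.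
(* Outside []0, 1]] the restriction [f] takes the default value [point], which is 0. *)
rewrite [point](_ : _ = 0%E)// add0e lee_fin ler_piMl ?expR_ge0//.
rewrite invf_le1 ?sqrtr_gt0//.
by rewrite -[leLHS]sqrtr1 ler_sqrt ?ltW.
Qed.

End exponential.

(** * Two-sided bounds for the exponential mixture of Gaussians *)

Section mixture_bounds.
Variable R : realType.
Local Notation leb := (@lebesgue_measure R).
Implicit Types k s x u eta : R.

Lemma normal_pdf_sqrt v x : 0 < v :> R ->
  normal_pdf 0 (Num.sqrt v) x =
  (Num.sqrt (v * pi *+ 2))^-1 * expR (- x ^+ 2 / (v *+ 2)).
Proof.
move=> v0; rewrite normal_pdfE ?gt_eqF ?sqrtr_gt0//.
by rewrite /normal_peak /normal_fun sqr_sqrtr ?subr0// ltW.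
Qed.

Lemma pi_ge1 : 1 <= pi :> R.
Proof. by apply: le_trans (pi_ge2 R); rewrite ler1n. Qed.

Lemma mixture_integrand_le u k eta s x :
  0 < u -> u <= k -> k <= 1 -> 0 < eta < 1 -> 0 < s ->
  normal_pdf 0 (Num.sqrt (s * k^-1)) x * (2^-1 * expR (- 2^-1 * s)) <=
  expR (- ((1 - eta) * (Num.sqrt u * `|x|))) *
    ((Num.sqrt s)^-1 * expR (- (eta / 2) * s)).
Proof.
move=> u0 uk k1 /andP[eta0 eta1] s0.
have k0 : 0 < k by exact: lt_le_trans uk.
have sk0 : 0 < s * k^-1 by rewrite divr_gt0.
rewrite normal_pdf_sqrt// mulrACA [leRHS]mulrCA; apply: ler_pM.
- by rewrite mulr_ge0 ?invr_ge0 ?sqrtr_ge0.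
- by rewrite mulr_ge0 ?expR_ge0.
(* The Gaussian normalising factor is at most the inverse square root of [s], because [k <= 1] makes
   [2 pi / k] at least 1. *)
- rewrite -[leRHS]mulr1 ler_pM ?invr_ge0 ?sqrtr_ge0//;
    last by rewrite invf_le1 ?ler1n.
  rewrite lef_pV2 ?posrE ?sqrtr_gt0 ?pmulrn_lgt0 ?mulr_gt0 ?invr_gt0 ?pi_gt0//.
  rewrite ler_wsqrtr//.
  rewrite -mulrnAr -mulrA ler_peMr ?ltW//.
  have : 1 <= k^-1 by rewrite invf_ge1.
  have := pi_ge1.
  by rewrite mulr2n => h1 h2; nra.
rewrite -!expRD ler_expR.
set y := Num.sqrt u * `|x|.
have yE : y ^+ 2 = u * x ^+ 2.
  by rewrite exprMn sqr_sqrtr ?(ltW u0)// real_normK// num_real.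
have -> : - x ^+ 2 / (s / k *+ 2) = - (k * x ^+ 2) / (2 * s).
  by field; rewrite !gt_eqF.
have h1 : y ^+ 2 / (2 * s) <= k * x ^+ 2 / (2 * s).
  rewrite ler_pM2r ?invr_gt0 ?mulr_gt0// yE ler_wpM2r ?sqr_ge0//.
have h2 : y <= y ^+ 2 / (2 * s) + s / 2.
  rewrite -subr_ge0.
  have -> : y ^+ 2 / (2 * s) + s / 2 - y = (y - s) ^+ 2 / (2 * s).
    by field; rewrite gt_eqF.
  by rewrite divr_ge0 ?sqr_ge0 ?mulr_ge0 ?ltW.
(* The exponents compare by adding [h1], [1 - eta] times [h2] and [eta] times [h3]. *)
have h3 : 0 <= y ^+ 2 / (2 * s) by rewrite divr_ge0 ?sqr_ge0 ?mulr_ge0 ?ltW.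
rewrite mulNr.
by nra.
Qed.

(** The negated exponent is [s / 2 + w ^+ 4 / (2 * s)], with minimum [w ^+ 2] at [s = w ^+ 2]. On
    the given window it exceeds this minimum by [(s - w ^+ 2) ^+ 2 / (2 * s)], which is at most
    2. *)
Lemma mixture_integrand_ge k s x (w := Num.sqrt (Num.sqrt k * `|x|)) :
  0 < k -> w ^+ 2 < s <= (w + 1) ^+ 2 ->
  2^-1 * (Num.sqrt (pi *+ 2 / k))^-1 * (w + 1)^-1 *
    expR (- (Num.sqrt k * `|x|) - 2) <=
  normal_pdf 0 (Num.sqrt (s * k^-1)) x * (2^-1 * expR (- 2^-1 * s)).
Proof.
move=> k0 /andP[ws sw].
have w0 : 0 <= w by exact: sqrtr_ge0.
have s0 : 0 < s by exact: le_lt_trans (sqr_ge0 w) ws.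
have sk0 : 0 < s * k^-1 by rewrite divr_gt0.
have w2 : w ^+ 2 = Num.sqrt k * `|x| by rewrite sqr_sqrtr// mulr_ge0 ?sqrtr_ge0.
have w4 : w ^+ 4 = k * x ^+ 2.
  rewrite (exprM _ 2 2) w2 exprMn sqr_sqrtr ?(ltW k0)// real_normK//.
  exact: num_real.
rewrite normal_pdf_sqrt//.
move: (pi) (pi_gt0 R) => p p0.
rewrite [leRHS]mulrACA -[X in X * expR _]mulrA.
rewrite [2^-1 * (_ * _)]mulrC; apply: ler_pM.
- by rewrite !mulr_ge0 ?invr_ge0 ?sqrtr_ge0 ?addr_ge0.
- exact: expR_ge0.
- rewrite ler_wpM2r ?invr_ge0// -invfM.
  have pk0 : 0 < p *+ 2 / k by rewrite divr_gt0 ?pmulrn_lgt0.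
  have -> : s / k * p *+ 2 = p *+ 2 / k * s by field; rewrite gt_eqF.
  rewrite lef_pV2 ?posrE ?mulr_gt0 ?sqrtr_gt0 ?ltr_wpDl//;
    last by rewrite mulr_gt0.
  rewrite sqrtrM ?(ltW pk0)//.
  rewrite ler_wpM2l ?sqrtr_ge0//.
  by rewrite -(@ger0_norm _ (w + 1)) ?addr_ge0// -sqrtr_sqr ler_wsqrtr.
rewrite -expRD ler_expR -w2.
have -> : - x ^+ 2 / (s / k *+ 2) = - (w ^+ 4) / (2 * s).
  by rewrite w4; field; rewrite !gt_eqF.
rewrite -subr_ge0.
have -> : - w ^+ 4 / (2 * s) + - 2^-1 * s - (- w ^+ 2 - 2) =
    (4 * s - (s - w ^+ 2) ^+ 2) / (2 * s).
  by field; rewrite gt_eqF.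
rewrite divr_ge0 ?mulr_ge0 ?(ltW s0)// subr_ge0.
(* With h = s - w^2 this is h^2 <= 4 (w^2 + h): clear if h <= 2 w, and otherwise
   (h - 2 w) (h + 2 w) <= 2 h as h - 2 w <= 1. *)
by have [h|h] := leP (s - w ^+ 2) (2 * w); nra.
Qed.

(** The integral is restricted to the window of the previous bound. Its length [2 * w + 1]
    compensates the factor [(w + 1)^-1], so that no power of [x] is lost. *)
Lemma mixture_ge k x : 0 < k ->
  ((2^-1 * expR (- 2) * (Num.sqrt (pi *+ 2 / k))^-1 *
      expR (- (Num.sqrt k * `|x|)))%:E <=
   \int[leb]_(s in `]0%R, +oo[)
     (normal_pdf 0 (Num.sqrt (s * k^-1)) x * (2^-1 * expR (- 2^-1 * s)))%:E)%E.
Proof.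
move=> k0; pose w := Num.sqrt (Num.sqrt k * `|x|).
have w0 : 0 <= w by exact: sqrtr_ge0.
pose c := 2^-1 * (Num.sqrt (pi *+ 2 / k))^-1 * (w + 1)^-1 *
    expR (- (Num.sqrt k * `|x|) - 2).
have c0 : 0 <= c.
  by rewrite !mulr_ge0 ?expR_ge0 ?invr_ge0 ?sqrtr_ge0 ?addr_ge0.
have mI : measurable_fun [set: R] (fun s : R =>
    (normal_pdf 0 (Num.sqrt (s * k^-1)) x * (2^-1 * expR (- 2^-1 * s)))%:E).
  apply/measurable_EFinP; apply: measurable_funM.
    apply: measurable_normal_pdf_comp => //; apply: measurable_fun_sqrt.
    exact: measurable_funM.
  apply: measurable_funM => //; apply: measurable_fun_expR.
  exact: measurable_funM.
apply: (@le_trans _ _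
  (\int[leb]_(s in `](w ^+ 2)%R, ((w + 1) ^+ 2)%R]) c%:E)%E).
  rewrite integral_cst//= lebesgue_measure_itv/= lte_fin ltrXn2r ?ltrDl//.
  rewrite -EFinB -EFinM lee_fin.
  have -> : c * ((w + 1) ^+ 2 - w ^+ 2) =
    2^-1 * expR (- 2) * (Num.sqrt (pi *+ 2 / k))^-1 *
      expR (- (Num.sqrt k * `|x|)) * ((2 * w + 1) / (w + 1)).
    rewrite /c expRD; move: (Num.sqrt (pi *+ 2 / k))^-1 => q; field.
    by rewrite gt_eqF// ltr_wpDl.
  rewrite ler_peMr ?mulr_ge0 ?expR_ge0 ?invr_ge0 ?sqrtr_ge0//.
  rewrite ler_pdivlMr ?ltr_wpDl// mul1r lerD2r; lra.
apply: (@le_trans _ _ (\int[leb]_(s in `](w ^+ 2)%R, ((w + 1) ^+ 2)%R])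
   (normal_pdf 0 (Num.sqrt (s * k^-1)) x * (2^-1 * expR (- 2^-1 * s)))%:E)%E).
  apply: ge0_le_integral => //.
  - exact: measurable_funTS.
  - move=> s; rewrite /= in_itv/= => sw; rewrite lee_fin.
    exact: mixture_integrand_ge.
apply: ge0_subset_integral => //.
- exact: measurable_funTS.
- by move=> s _; rewrite lee_fin mulr_ge0 ?normal_pdf_ge0 ?mulr_ge0 ?expR_ge0.
- by apply: subset_itv; rewrite bnd_simp ?sqr_ge0.
Qed.

End mixture_bounds.

(** * The marginal law of an observation *)

Section marginal.
Context (R : realType) (K a : R) (L : R -> R) (tau : R) (n : nat)
  (d : measure_display) (T : measurableType d) (P : probability T R)
  (X theta lambda2 sigma2 : 'I_n -> {RV P >-> R}).
Hypothesis model : hierarchical_model K a L tau X theta lambda2 sigma2.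
Variable i : 'I_n.

(** Rectangles that constrain the [i]-th coordinate alone; they specialise the laws of the whole
    model to the index [i]. *)
Let only (A : set R) (j : 'I_n) : set R := if j == i then A else setT.

Let measurable_only A j : measurable A -> measurable (only A j).
Proof. by rewrite /only; case: ifP. Qed.

Let prod_only (F : 'I_n -> set R -> \bar R) A :
  (forall j, F j setT = 1%E) ->
  (\big[*%E/1%E]_(j < n) F j (only A j) = F i A)%E.
Proof.
move=> F1; rewrite (bigD1 i)//= {1}/only eqxx big1 ?mule1// => j ji.
by rewrite /only (negbTE ji).
Qed.

Lemma scales_independent1 C D : measurable C -> measurable D ->
  (P (lambda2 i @^-1` C `&` sigma2 i @^-1` D) =
   distribution P (lambda2 i) C * exponential_prob (2^-1 : R) D)%E.
Proof.
move=> mC mD; have mC' j := measurable_only j mC.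
have mD' j := measurable_only j mD.
rewrite -(sigma2_law model i mD).
have := scales_independent model mC' mD'.
rewrite (prod_only (F := fun j A => P (lambda2 j @^-1` A))); last first.
  by move=> j; rewrite preimage_setT probability_setT.
rewrite (prod_only (F := fun j A => P (sigma2 j @^-1` A))); last first.
  by move=> j; rewrite preimage_setT probability_setT.
move=> <-; congr (P _); apply/seteqP; split => [w [Cw Dw] j|w /(_ i)] /=.
  by rewrite /only; case: eqP => [->|_].
by rewrite /only eqxx.
Qed.

Lemma theta_law1 C D B : measurable C -> measurable D -> measurable B ->
  (P (lambda2 i @^-1` C `&` sigma2 i @^-1` D `&` theta i @^-1` B) =
   \int[P]_(w in lambda2 i @^-1` C `&` sigma2 i @^-1` D)
     \int[lebesgue_measure]_(t in B) (normal_pdf 0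
        (Num.sqrt (sigma2 i w * lambda2 i w * tau ^+ 2)) t)%:E)%E.
Proof.
move=> mC mD mB; have mC' j := measurable_only j mC.
have mD' j := measurable_only j mD; have mB' j := measurable_only j mB.
have := theta_law model mB' mC' mD'.
have -> : [set w | forall j, [/\ only B j (theta j w),
      only C j (lambda2 j w) & only D j (sigma2 j w)]] =
    lambda2 i @^-1` C `&` sigma2 i @^-1` D `&` theta i @^-1` B.
  apply/seteqP; split => [w /(_ i)|w [[Cw Dw] Bw] j] /=.
    by rewrite /only eqxx => -[].
  by rewrite /only; case: eqP => [->|_].
have -> : [set w | forall j, only C j (lambda2 j w) /\ only D j (sigma2 j w)] =
    lambda2 i @^-1` C `&` sigma2 i @^-1` D.
  apply/seteqP; split => [w /(_ i)|w [Cw Dw] j] /=.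
    by rewrite /only eqxx.
  by rewrite /only; case: eqP => [->|_].
move=> ->; apply: eq_integral => w _.
rewrite (prod_only (F := fun j A => normal_prob 0
  (Num.sqrt (sigma2 j w * lambda2 j w * tau ^+ 2)) A))//.
by move=> j; rewrite probability_setT.
Qed.

(** This discards the values [l <= 0], for which [s * l * tau ^+ 2] is not a positive variance and
    the Gaussian convolution does not apply. *)
Lemma lambda2_le0 : distribution P (lambda2 i) `]-oo, 0%R] = 0%E.
Proof.
rewrite (lambda2_law model)// (_ : _ `&` _ = set0) ?integral_set0//.
apply/seteqP; split => // s []; rewrite /= !in_itv/= andbT => s0.
by rewrite ltNge s0.
Qed.

(** Given [lambda2 = l] and [sigma2 = s], integrating [theta] out convolves two Gaussians, and the
    variances add up to [s + s * l * tau ^+ 2]. *)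
Lemma marginal_integral (k : R -> R) (x : R) : 0 < tau ->
  measurable_fun setT k -> (forall l, 0 <= k l) ->
  (\int[P]_w (k (lambda2 i w) *
      normal_pdf (theta i w) (Num.sqrt (sigma2 i w)) x)%:E =
   \int[distribution P (lambda2 i)]_(l in `]0%R, +oo[)
     ((k l)%:E * \int[lebesgue_measure]_(s in `]0%R, +oo[)
       (normal_pdf 0 (Num.sqrt (s * (1 + l * tau ^+ 2))) x *
         (2^-1 * expR (- 2^-1 * s)))%:E))%E.
Proof.
move=> tau0 mk k0.
have half0 : 0 < 2^-1 :> R by rewrite invr_gt0.
(* [R] and [measurableTypeR R] have the same measurable sets but are distinct
   instances: [distribution] lives on the former and [lebesgue_measure], hence
   [exponential_prob], on the latter. *)
pose ex : probability (measurableTypeR R) R := exponential_prob (2^-1 : R).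
pose p (v : R * measurableTypeR R) (t : measurableTypeR R) : R :=
  normal_pdf 0 (Num.sqrt (v.2 * v.1 * tau ^+ 2)) t.
pose g (z : R * measurableTypeR R * measurableTypeR R) : \bar R :=
  (k z.1.1 * normal_pdf z.2 (Num.sqrt z.1.2) x)%:E.
pose T3 : measurableType _ := (R * measurableTypeR R * measurableTypeR R)%type.
have m11 : measurable_fun setT (fun z : T3 => z.1.1).
  exact: measurableT_comp.
have m12 : measurable_fun setT (fun z : T3 => z.1.2 : R).
  exact: measurableT_comp.
have m2 : measurable_fun setT (fun z : T3 => z.2 : R).
  exact: measurable_snd.
have mp : measurable_fun setT (fun z : T3 => p z.1 z.2).
  apply: measurable_normal_pdf_comp => //; apply: measurable_fun_sqrt.
  by apply: measurable_funM => //; exact: measurable_funM.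
have p0 v t : 0 <= p v t by exact: normal_pdf_ge0.
have mg : measurable_fun setT g.
  apply/measurable_EFinP; apply: measurable_funM.
    exact: measurableT_comp.
  by apply: measurable_normal_pdf_comp => //; exact: measurable_fun_sqrt.
have g0 z : (0 <= g z)%E by rewrite lee_fin mulr_ge0 ?normal_pdf_ge0.
transitivity (\int[P]_w g (lambda2 i w, sigma2 i w, theta i w))%E => //.
rewrite (@ge0_integral_joint_density _ _ _ _ T R (measurableTypeR R)
  (measurableTypeR R) R P (lambda2 i) (sigma2 i)
  (theta i) (distribution P (lambda2 i)) (ex half0) (@lebesgue_measure R) p)//;
  last 4 first.
- exact: (measurable_funP (sigma2 i)).
- exact: (measurable_funP (theta i)).
- by move=> C D mC mD; exact: scales_independent1.
- by move=> C D B mC mD mB; exact: theta_law1.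
(* [F] and [G] are the successive partial integrals of [f], over [theta] and then [sigma2]; Tonelli
   supplies their measurability. *)
pose f z := (g z * (p z.1 z.2)%:E)%E.
have mf : measurable_fun setT f.
  by apply: emeasurable_funM => //; exact/measurable_EFinP.
have f0 z : (0 <= f z)%E by rewrite mule_ge0 ?g0 ?lee_fin.
pose F := fubini_F (@lebesgue_measure R) f.
have mF : measurable_fun setT F by exact: measurable_fun_fubini_tonelli_F.
have F0 v : (0 <= F v)%E by exact: integral_ge0.
pose G := fubini_F (ex half0) F.
have mG : measurable_fun setT G by exact: measurable_fun_fubini_tonelli_F.
have G0 l : (0 <= G l)%E by exact: integral_ge0.
rewrite -[LHS]/(\int[distribution P (lambda2 i)]_l G l)%E.
rewrite (@ge0_negligible_integral _ R R (distribution P (lambda2 i)) setT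
  `]-oo, 0%R]%classic)//;
  last exact: lambda2_le0.
have -> : setT `\` `]-oo, 0%R]%classic = `]0%R, +oo[%classic :> set R.
  by rewrite setTD setCitvl.
apply: eq_integral => l; rewrite inE/= in_itv/= andbT => l0.
have mFl : measurable_fun setT (fun s => F (l, s)).
  exact: (measurableT_comp mF (pair1_measurable l)).
have Fl0 s : (0 <= F (l, s))%E by exact: F0.
rewrite [LHS](ge0_integral_exponential half0 (fun _ _ => erefl) mFl Fl0).
rewrite -ge0_integralZl_EFin//; last first.
  apply: measurable_funTS; apply/measurable_EFinP; apply: measurable_funM.
    apply: measurable_normal_pdf_comp => //; apply: measurable_fun_sqrt.
    exact: measurable_funM.
  apply: measurable_funM => //; apply: measurable_fun_expR.
  exact: measurable_funM.
  by move=> s _; rewrite lee_fin mulr_ge0 ?normal_pdf_ge0 ?mulr_ge0 ?expR_ge0.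
apply: eq_integral => s; rewrite inE/= in_itv/= andbT => s0.
rewrite [in RHS]EFinM [RHS]muleA; congr (_ * _)%E.
have slt0 : 0 < s * l * tau ^+ 2 by rewrite !mulr_gt0.
transitivity (\int[lebesgue_measure]_t ((k l)%:E *
    (normal_pdf t (Num.sqrt s) x *
      normal_pdf 0 (Num.sqrt (s * l * tau ^+ 2)) t)%:E))%E.
  rewrite /F /fubini_F; apply: eq_integral => t _.
  by rewrite /f /g /p/= -!EFinM; congr (_%:E); exact/esym/mulrA.
pose h (t : measurableTypeR R) : \bar R := (normal_pdf t (Num.sqrt s) x *
  normal_pdf 0 (Num.sqrt (s * l * tau ^+ 2)) t)%:E.
have h0 : forall y, [set: R] y -> (0 <= h y)%E.
  by move=> y _; rewrite lee_fin mulr_ge0 ?normal_pdf_ge0.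
have mh : measurable_fun setT h.
  apply/measurable_EFinP; apply: measurable_funM.
    exact: measurable_normal_pdf_comp.
  exact: measurable_normal_pdf.
transitivity ((k l)%:E * \int[lebesgue_measure]_t h t)%E.
  exact: (ge0_integralZl_EFin (@lebesgue_measure R) measurableT h0 mh (k0 l)).
rewrite /h normal_pdf_convolution ?sqrtr_gt0//.
rewrite !sqr_sqrtr ?(ltW s0) ?(ltW slt0)//.
by rewrite mulrDr mulr1 mulrA.
Qed.

End marginal.

(** * The bound on the posterior expectation *)

(** Extended by 0 to the whole line, the positive function [L] stays nondecreasing, hence is
    measurable. *)
Lemma measurable_prior_density (R : realType) (K a : R) (L : R -> R) :
  (forall x : R, 0 < x -> 0 < L x) ->
  (forall x y : R, 0 < x -> x <= y -> L x <= L y) ->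
  measurable_fun (`]0, +oo[%classic : set R) (local_prior_density K a L).
Proof.
move=> L0 Lnd; apply: measurable_funM.
  apply: measurable_funM => //; apply: measurable_funTS.
  exact: measurable_powR.
pose D : set R := `]0, +oo[%classic.
apply: (@eq_measurable_fun _ _ _ _ D (L \_ D)).
  by move=> x xD; rewrite patchE xD.
apply: measurable_funTS; apply: nondecreasing_measurable => // x y xy.
rewrite !patchE !mem_setE !in_itv/= !andbT.
have [x0|x0] := ltP 0 x; first by rewrite (lt_le_trans x0 xy) Lnd.
by case: ifPn => // y0; rewrite ltW ?L0.
Qed.

(** On this interval [L] is at least [L A], as [tau < 1], and the decreasing power is at least its
    value at the right end, which scales like [tau] to the power [2 * a + 2]. The length
    [A * tau ^- 2] of the interval brings this down to [2 * a]. *)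
Lemma prior_mass_ge (R : realType) (K a : R) (L : R -> R) (tau A : R)
  (mu : set R -> \bar R) :
  0 < a -> 0 < K -> 0 < tau < 1 -> 0 < A ->
  (forall x y : R, 0 < x -> x <= y -> L x <= L y) ->
  (forall x, 0 < x -> 0 < L x) ->
  (forall C, measurable C -> mu C =
    \int[lebesgue_measure]_(l in C `&` `]0%R, +oo[)
       (local_prior_density K a L l)%:E)%E ->
  ((K * L A * (2 * A) `^ (- a - 1) * A * tau `^ (2 * a))%:E <=
     mu `[(A * tau ^- 2)%R, (2 * A * tau ^- 2)%R]%classic)%E.
Proof.
move=> a0 K0 /andP[tau0 tau1] A0 Lnd L0 muE.
have t2 : 0 < tau ^- 2 by rewrite invr_gt0 exprn_gt0.
have lo0 : 0 < A * tau ^- 2 by rewrite mulr_gt0.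
have lohi : A * tau ^- 2 < 2 * A * tau ^- 2.
  by rewrite ltr_pM2r// ltr_pMl// ltr1n.
rewrite muE// setIidl; last first.
  by apply: subset_itv; rewrite bnd_simp.
pose c := K * L A * (2 * A * tau ^- 2) `^ (- a - 1).
have LA0 := L0 _ A0.
apply: (@le_trans _ _ (\int[lebesgue_measure]_(l in
    `[(A * tau ^- 2)%R, (2 * A * tau ^- 2)%R]) c%:E)%E).
  rewrite integral_cst//= lebesgue_measure_itv/= lte_fin lohi -EFinB -EFinM.
  rewrite lee_fin /c.
  have A20 : 0 <= 2 * A by rewrite mulr_ge0 // ltW.
  rewrite (powRM _ A20 (ltW t2)).
  have -> : (tau ^- 2) `^ (- a - 1) = tau `^ (2 * a) * tau ^+ 2.
    rewrite -powR_mulrn ?ltW// -powRN -powRrM -powRD; last first.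
      by rewrite (gt_eqF tau0) implybT.
    by congr (_ `^ _); ring.
  rewrite le_eqVlt; apply/orP; left; apply/eqP; field.
  by rewrite gt_eqF.
apply: ge0_le_integral => //.
- by move=> l _; rewrite lee_fin !mulr_ge0 ?powR_ge0 ?ltW.
- apply/measurable_EFinP;
  apply: measurable_funS (measurable_prior_density K a L0 Lnd) => //.
  by apply: subset_itv; rewrite bnd_simp.
move=> l; rewrite /= in_itv/= => /andP[lol lhi]; rewrite lee_fin.
have l0 : 0 < l by exact: lt_le_trans lol.
rewrite /c /local_prior_density mulrAC; apply: ler_pM.
- by rewrite mulr_ge0 ?powR_ge0// ltW.
- exact: ltW.
- rewrite ler_wpM2l ?(ltW K0)//.
  rewrite -opprD !powRN lef_pV2 ?posrE ?powR_gt0 ?(lt_le_trans l0)//.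
  by rewrite ge0_ler_powR ?nnegrE ?addr_ge0 ?(ltW l0) ?(ltW a0)//
    (le_trans (ltW l0)).
- apply: Lnd => //; apply: le_trans lol.
rewrite ler_peMr ?(ltW A0)// invf_ge1 ?exprn_gt0//.
rewrite exprn_ile1 ?(ltW tau0) ?(ltW tau1)//.
Qed.

Theorem lemma4p2 (R : realType) (a K M : R) (L : R -> R) (n : nat)
  (a_gt0 : 0 < a) (K_gt0 : 0 < K)
  (L_slow : slowly_varying L)
  (L_nondecreasing : forall x y : R, 0 < x -> x <= y -> L x <= L y)
  (L_bounds : forall x : R, 0 < x -> 0 < L x <= M)
  (K_normalizing :
     (\int[lebesgue_measure]_(l in `]0%R, +oo[)
        (local_prior_density K a L l)%:E)%E = 1%E)
  (u delta : R) (u01 : 0 < u < 1) (delta01 : 0 < delta < 1) :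
  exists C : R, 0 < C /\
    forall tau : R, 0 < tau < 1 ->
    forall (d : measure_display) (T : measurableType d) (P : probability T R)
      (X theta lambda2 sigma2 : 'I_n -> {RV P >-> R}),
    hierarchical_model K a L tau X theta lambda2 sigma2 ->
    forall (i : 'I_n) (x : R),
      let kappa w := shrinkage tau (lambda2 i w) in
      posterior_expectation (theta i) (sigma2 i) x
        (fun w => kappa w * \1_[set v | u < kappa v] w)
      <= C * tau `^ (- (2 * a)) *
         expR (- (Num.sqrt u * (1 - Num.sqrt delta) * `|x|)).
Proof.
have [u0 u1] := andP u01; have [delta0 delta1] := andP delta01.
set q := Num.sqrt u; pose r := Num.sqrt delta; pose eta := r / 2.
have q0 : 0 < q by rewrite sqrtr_gt0.
have r0 : 0 < r by rewrite sqrtr_gt0.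
have r1 : r < 1 by rewrite -sqrtr1 ltr_sqrt.
have eta01 : 0 < eta < 1 by rewrite /eta; lra.
have [eta0 eta1] := andP eta01.
(* If [l * tau ^+ 2] lies between [A] and [2 * A], then [kappa] is at most [(q * eta) ^+ 2] and at
   least [k0]. Neither bound depends on [tau]. *)
pose A := (q * eta) ^- 2.
have A0 : 0 < A by rewrite invr_gt0 exprn_gt0// mulr_gt0.
have LA0 : 0 < L A by have /andP[] := L_bounds _ A0.
pose k0 := (1 + 2 * A)^-1.
have k0_gt0 : 0 < k0 by rewrite invr_gt0 ltr_pwDl// mulr_ge0 ?ltW.
pose J := (\int[lebesgue_measure]_(s in `]0%R, +oo[)
   ((Num.sqrt s)^-1 * expR (- (eta / 2) * s))%:E)%E.
have Joo : (J < +oo)%E by apply: integral_invsqrt_exp_lty; rewrite divr_gt0.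
have J0 : (0 <= J)%E.
  apply: integral_ge0 => s _.
  by rewrite lee_fin mulr_ge0 ?expR_ge0 ?invr_ge0 ?sqrtr_ge0.
pose j := fine J; have JE : J = j%:E by rewrite fineK// ge0_fin_numE.
have j0 : 0 <= j by rewrite fine_ge0.
have pk y : 0 < y -> 0 < pi *+ 2 / y :> R.
  by move=> y0; apply: divr_gt0; rewrite // pmulrn_lgt0// pi_gt0.
pose b := 2^-1 * expR (- 2) * (Num.sqrt (pi *+ 2 / k0))^-1 : R.
have b0 : 0 < b.
  rewrite mulr_gt0 ?mulr_gt0 ?expR_gt0 ?invr_gt0 ?sqrtr_gt0//.
  by rewrite pk.
pose m := K * L A * (2 * A) `^ (- a - 1) * A.
have m0 : 0 < m by rewrite !mulr_gt0 ?powR_gt0 ?mulr_gt0.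
(* [j] comes from the bound on the numerator, [b] and [m] from the mixture and the prior mass in the
   denominator. Since [j] is only known to be nonnegative, [j + 1] secures [0 < C]. *)
exists ((j + 1) / (b * m)); split.
  by rewrite divr_gt0 ?ltr_wpDl// mulr_gt0.
move=> tau tau01 d T P X theta lambda2 sigma2 model i x; cbv zeta.
have [tau0 tau1] := andP tau01.
rewrite /posterior_expectation !expectation.unlock.
pose kap l : R := shrinkage tau l.
have mkap : measurable_fun setT kap.
  apply: measurable_fun_inv; apply: measurable_funD => //.
  exact: measurable_funM.
have kap_gt0 l : 0 < l -> 0 < kap l.
  by move=> l0; rewrite invr_gt0 addr_gt0// mulr_gt0 ?exprn_gt0.
pose D := (fun k : R => (\int[lebesgue_measure]_(s in `]0%R, +oo[)
  (normal_pdf 0 (Num.sqrt (s * k^-1)) x * (2^-1 * expR (- 2^-1 * s)))%:E)%E).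
have Dge0 k : (0 <= D k)%E.
  apply: integral_ge0 => s _.
  by rewrite lee_fin mulr_ge0 ?normal_pdf_ge0 ?mulr_ge0 ?expR_ge0.
have DE l : (\int[lebesgue_measure]_(s in `]0%R, +oo[)
       (normal_pdf 0 (Num.sqrt (s * (1 + l * tau ^+ 2))) x *
         (2^-1 * expR (- 2^-1 * s)))%:E)%E = D (kap l).
  by rewrite /D /kap /shrinkage invrK.
have mD : measurable_fun setT (fun l => D (kap l)).
  (* Truncating the exponential weight turns [D (kap l)] into a partial integral over the whole
     line, to which Tonelli applies. *)
  pose e := (fun s : R => 2^-1 * expR (- 2^-1 * s)) \_ `]0, +oo[.
  pose f (z : R * measurableTypeR R) :=
    (normal_pdf 0 (Num.sqrt (z.2 * (kap z.1)^-1)) x * e z.2)%:E.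
  have m1 : measurable_fun setT (fun z : R * measurableTypeR R => kap z.1).
    exact: (measurableT_comp mkap measurable_fst).
  have m2 : measurable_fun setT (fun z : R * measurableTypeR R => z.2 : R).
    exact: measurable_snd.
  have mf : measurable_fun setT f.
    apply/measurable_EFinP; apply: measurable_funM.
      apply: measurable_normal_pdf_comp => //; apply: measurable_fun_sqrt.
      by apply: measurable_funM => //; exact: measurable_fun_inv.
    apply: (@measurableT_comp _ _ _ _ _ _ e) => //.
    apply/measurable_restrict => //; apply: measurable_funTS.
    apply: measurable_funM => //; apply: measurable_fun_expR.
    exact: measurable_funM.
  have f0 z : (0 <= f z)%E.
    rewrite lee_fin mulr_ge0 ?normal_pdf_ge0// /e patchE.
    by case: ifP => _; rewrite ?mulr_ge0 ?expR_ge0.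
  rewrite (_ : (fun l => D (kap l)) = fubini_F (@lebesgue_measure R) f).
    exact: measurable_fun_fubini_tonelli_F.
  apply/funext => l; rewrite /D /fubini_F [LHS]integral_mkcond.
  apply: eq_integral => s _; rewrite /f /e !patchE /=; case: ifP => // _.
  by rewrite mulr0.
pose h l := kap l * \1_[set l | u < kap l] l.
have mh : measurable_fun setT h.
  apply: measurable_funM => //; apply: measurable_indic.
  rewrite (_ : [set l | _] = kap @^-1` `]u, +oo[%classic).
    by rewrite -[X in measurable X]setTI; exact: mkap.
  by apply/seteqP; split => l; rewrite /= in_itv/= andbT.
have h0 l : 0 <= h l.
  rewrite /h indicE; case: (boolP (_ \in _)) => [|_]; last by rewrite mulr0.
  by rewrite inE/= mulr1 => /ltW; exact/le_trans/ltW.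
pose E1 := expR (- ((1 - eta) * (q * `|x|))).
pose E2 := expR (- (q * eta * `|x|)).
have mI k : measurable_fun (`]0, +oo[%classic : set R) (fun s : R =>
    (normal_pdf 0 (Num.sqrt (s * k^-1)) x * (2^-1 * expR (- 2^-1 * s)))%:E).
  apply: measurable_funTS; apply/measurable_EFinP; apply: measurable_funM.
    apply: measurable_normal_pdf_comp => //; apply: measurable_fun_sqrt.
    exact: measurable_funM.
  apply: measurable_funM => //; apply: measurable_fun_expR.
  exact: measurable_funM.
have D_le k : u <= k -> k <= 1 -> (D k <= (E1 * j)%:E)%E.
  move=> uk k1; rewrite EFinM -JE.
  have mJ : measurable_fun (`]0, +oo[%classic : set R)
      (fun s : R => ((Num.sqrt s)^-1 * expR (- (eta / 2) * s))%:E).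
    apply: measurable_funTS; apply/measurable_EFinP; apply: measurable_funM.
      by apply/measurable_fun_inv/measurable_fun_sqrt.
    by apply: measurable_fun_expR; exact: measurable_funM.
  have Jge0 (s : R) : `]0, +oo[%classic s ->
      (0 <= ((Num.sqrt s)^-1 * expR (- (eta / 2) * s))%:E)%E.
    by move=> _; rewrite lee_fin mulr_ge0 ?expR_ge0 ?invr_ge0 ?sqrtr_ge0.
  rewrite -(ge0_integralZl_EFin (@lebesgue_measure R) (measurable_itv _) Jge0 mJ
    (expR_ge0 _)).
  apply: ge0_le_integral => //.
  - by move=> s _; rewrite lee_fin mulr_ge0 ?normal_pdf_ge0 ?mulr_ge0 ?expR_ge0.
  - exact: mI.
  - by apply: emeasurable_funM.
  - move=> s; rewrite /= in_itv/= andbT => s0; rewrite -EFinM lee_fin.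
    exact: mixture_integrand_le.
have D_ge k : k0 <= k -> k <= (q * eta) ^+ 2 -> ((b * E2)%:E <= D k)%E.
  move=> k0k kq; have kgt0 : 0 < k by exact: lt_le_trans k0k.
  apply: le_trans (mixture_ge x kgt0); rewrite lee_fin.
  apply: ler_pM; rewrite ?expR_ge0 ?(ltW b0)//.
    rewrite ler_wpM2l ?mulr_ge0 ?expR_ge0//.
    rewrite lef_pV2 ?posrE ?sqrtr_gt0 ?pk// ler_wsqrtr//.
    apply: ler_wpM2l; first by rewrite mulrn_wge0 ?pi_ge0.
    by rewrite lef_pV2 ?posrE.
  rewrite ler_expR lerN2 ler_wpM2r//.
  by rewrite -(ger0_norm (mulr_ge0 (ltW q0) (ltW eta0))) -sqrtr_sqr ler_wsqrtr.
have kap_le1 l : 0 < l -> kap l <= 1.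
  move=> l0; rewrite invf_le1 ?lerDl ?mulr_ge0 ?sqr_ge0 ?ltW//.
  by rewrite addr_gt0// mulr_gt0// exprn_gt0.
(* The weight [h] is at most 1 and vanishes unless [u < kap l], where [D_le] applies; the law of
   [lambda2 i] has mass at most 1. *)
have num_le : (\int[P]_w (shrinkage tau (lambda2 i w) *
      \1_[set v | (u < shrinkage tau (lambda2 i v))%R] w *
      normal_pdf (theta i w) (Num.sqrt (sigma2 i w)) x)%:E <= (E1 * j)%:E)%E.
  rewrite [leLHS](marginal_integral model i x tau0 mh h0).
  under eq_integral do rewrite DE.
  apply: (@le_trans _ _ (\int[distribution P (lambda2 i)]_(l in `]0%R, +oo[)
      (E1 * j)%:E)%E).
    apply: ge0_le_integral => //.
    - by move=> l _; rewrite mule_ge0 ?lee_fin.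
    - apply: measurable_funTS; apply: emeasurable_funM => //.
      exact/measurable_EFinP.
    - move=> l; rewrite /= in_itv/= andbT => l0.
      rewrite /h indicE; case: (boolP (_ \in _)) => [|_].
        rewrite inE/= => ukl; rewrite mulr1.
        apply: (le_trans _ (D_le (kap l) (ltW ukl) (kap_le1 l l0))).
        by rewrite -[leRHS]mul1e lee_wpmul2r// lee_fin kap_le1.
      by rewrite mulr0 mul0e lee_fin mulr_ge0 ?expR_ge0.
  rewrite integral_cst// -[leRHS]mule1 lee_pmul ?lee_fin ?mulr_ge0 ?expR_ge0//.
  exact: probability_le1.
have den_ge : ((b * E2 * (m * tau `^ (2 * a)))%:E <=
    \int[P]_w (normal_pdf (theta i w) (Num.sqrt (sigma2 i w)) x)%:E)%E.
  have -> : (\int[P]_w (normal_pdf (theta i w) (Num.sqrt (sigma2 i w)) x)%:E =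
      \int[P]_w (cst 1 (lambda2 i w) *
        normal_pdf (theta i w) (Num.sqrt (sigma2 i w)) x)%:E)%E.
    by apply: eq_integral => w _; rewrite mul1r.
  rewrite [leRHS](marginal_integral model i x tau0 (measurable_cst _)
    (fun=> ler01)).
  under eq_integral do rewrite DE mul1e.
  (* Only this range of [lambda2] is kept: [D_ge] holds on it, and [prior_mass_ge] bounds its
     mass. *)
  pose I : set R := `[(A * tau ^- 2), (2 * A * tau ^- 2)]%classic.
  have t2 : 0 < tau ^+ 2 by rewrite exprn_gt0.
  have lo0 : 0 < A * tau ^- 2 by rewrite divr_gt0.
  apply: (@le_trans _ _ (\int[distribution P (lambda2 i)]_(l in I)
    (b * E2)%:E)%E).
    rewrite integral_cst//; last exact: measurable_itv.
    rewrite [(b * E2 * _)%:E]EFinM lee_wpmul2l//;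
      first by rewrite lee_fin mulr_ge0 ?expR_ge0 ?(ltW b0).
    apply: prior_mass_ge => //; last exact: (lambda2_law model).
    by move=> y /L_bounds/andP[].
  apply: (@le_trans _ _ (\int[distribution P (lambda2 i)]_(l in I)
    D (kap l))%E).
    apply: ge0_le_integral => //.
    - exact: measurable_itv.
    - by move=> l _; rewrite lee_fin mulr_ge0 ?expR_ge0 ?(ltW b0).
    - exact: measurable_funTS.
    - move=> l; rewrite /I /= in_itv/= ler_pdivrMr// ler_pdivlMr//.
      move=> /andP[lol lhi].
      have l0 : 0 < l * tau ^+ 2 by exact: lt_le_trans lol.
      have p1 : 0 < 1 + l * tau ^+ 2 by exact: addr_gt0.
      have p2 : 0 < 1 + 2 * A by rewrite -invr_gt0.
      apply: D_ge; first by rewrite lef_pV2 ?posrE// lerD2l.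
      have qe : 0 < (q * eta) ^- 2 by exact: A0.
      by rewrite -[leRHS]invrK lef_pV2 ?posrE// (le_trans lol)// lerDr.
  apply: ge0_subset_integral => //.
  - exact: measurable_itv.
  - exact: measurable_funTS.
  - by apply: subset_itv; rewrite bnd_simp.
set N := (\int[P]_w (shrinkage tau (lambda2 i w) * _ * _)%:E)%E in num_le *.
set Q := (\int[P]_w (normal_pdf _ _ _)%:E)%E in den_ge *.
have N0 : (0 <= N)%E.
  apply: integral_ge0 => w _; rewrite lee_fin mulr_ge0 ?normal_pdf_ge0//.
  exact: (h0 (lambda2 i w)).
have rhs0 : 0 <= (j + 1) / (b * m) * tau `^ (- (2 * a)) *
         expR (- (q * (1 - Num.sqrt delta) * `|x|)).
  rewrite mulr_ge0 ?expR_ge0// mulr_ge0 ?powR_ge0// divr_ge0 ?addr_ge0//.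
  by rewrite ltW// mulr_gt0.
have N_le : fine N <= E1 * j.
  rewrite -lee_fin fineK// ge0_fin_numE//.
  by apply: le_lt_trans num_le _; rewrite ltry.
(* [fine +oo = 0], so that the quotient is then [0]. *)
have [Qoo|Qoo] := eqVneq Q +oo%E; first by rewrite Qoo/= invr0 mulr0.
have d0 : 0 < b * E2 * (m * tau `^ (2 * a)).
  apply: mulr_gt0; apply: mulr_gt0 => //; first exact: expR_gt0.
  exact: powR_gt0.
have Qfin : Q \is a fin_num.
  by rewrite ge0_fin_numE ?ltey// (le_trans _ den_ge)// lee_fin ltW.
have Q_ge : b * E2 * (m * tau `^ (2 * a)) <= fine Q by rewrite -lee_fin fineK.
have Q0 : 0 < fine Q by exact: lt_le_trans Q_ge.
rewrite ler_pdivrMr//; apply: (le_trans N_le).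
apply: le_trans (ler_wpM2l rhs0 Q_ge).
(* [eta] is spent once in the numerator and once in the denominator, and [1 - 2 * eta = 1 - r]. *)
have -> : E1 = E2 * expR (- (q * (1 - Num.sqrt delta) * `|x|)).
  by rewrite -expRD; congr expR; rewrite /eta -/r; field.
rewrite powRN.
set e := expR (- (q * (1 - _) * _)); set t := tau `^ _.
have t0 : t != 0 by rewrite gt_eqF ?powR_gt0.
have -> : (j + 1) / (b * m) * t^-1 * e * (b * E2 * (m * t)) = E2 * e * (j + 1).
  by field; rewrite t0 !gt_eqF.
by rewrite ler_wpM2l ?mulr_ge0 ?expR_ge0// lerDl.
Qed.
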